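(* Let $N\ge 1$ be an integer, $s\in(0,1)$, and let $\varphi:(0,\infty)\to(0,\infty)$ be a $C^1$ function, with $t\mapsto t\varphi(t)$ twice differentiable, such that: $t\varphi(t)\to 0$ as $t\to 0$ and $t\varphi(t)\to\infty$ as $t\to\infty$; $t\mapsto t\varphi(t)$ is strictly increasing on $(0,\infty)$; $-1<\ell-2:=\inf_{t>0}\frac{(t\varphi(t))''t}{(t\varphi(t))'}\le\sup_{t>0}\frac{(t\varphi(t))''t}{(t\varphi(t))'}=:m-2<\infty$; and, with $\Phi(t)=\int_0^{|t|}\tau\varphi(\tau)\,d\tau$, $\int_0^1\left(\frac{t}{\Phi(t)}\right)^{\frac{s}{N-s}}dt<\infty$ and $\int_1^\infty\left(\frac{t}{\Phi(t)}\right)^{\frac{s}{N-s}}dt=\infty$. Let $q,p$ satisfy $\ell\le m<q<p<\ell_s^*:=\frac{N\ell}{N-\ell s}$ and $m(q-\ell)<p(q-m)$. Let $a:\mathbb{R}^N\to\mathbb{R}$ be measurable with $a\in L^{p/(p-q)}(\mathbb{R}^N)$ and $a>0$ a.e. Let $V:\mathbb{R}^N\to\mathbb{R}$ be continuous, with $V\ge V_0$ on $\mathbb{R}^N$ for some constant $V_0>0$, and such that for each $M>0$ the set $\{x:V(x)\le M\}$ has finite Lebesgue measure. Suppose $\lambda>0$ and $\mu\in(-\infty,\mu_n(\lambda))$. Then the problem $$(-\Delta_\Phi)^su+V(x)\varphi(|u|)u=\mu a(x)|u|^{q-2}u-\lambda|u|^{p-2}u\ \text{ in }\mathbb{R}^N,\qquad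 u\in W^{s,\Phi}(\mathbb{R}^N),$$ does not admit any nontrivial weak solution.
   Context: Notation. $D_su(x,y)=\frac{u(x)-u(y)}{|x-y|^s}$ and $d\nu=\frac{dx\,dy}{|x-y|^N}$ on $\mathbb{R}^N\times\mathbb{R}^N$. $W^{s,\Phi}(\mathbb{R}^N)$ is the fractional Orlicz–Sobolev space of functions $u\in L^\Phi(\mathbb{R}^N)$ (Orlicz space) with $\iint\Phi(D_su/\kappa)\,d\nu<\infty$ for some $\kappa>0$. Put $X=\{u\in W^{s,\Phi}(\mathbb{R}^N):\int V\Phi(u)\,dx<\infty\}$, $\mathcal{J}(u)=\iint\Phi(D_su)\,d\nu+\int V\Phi(u)\,dx$, with norm $\|u\|=\inf\{\kappa>0:\mathcal{J}(u/\kappa)\le1\}$ on $X$. Its derivative is $\mathcal{J}'(u)v=\iint\varphi(|D_su|)D_su\,D_sv\,d\nu+\int V\varphi(|u|)uv\,dx$ (integrands are $0$ where the argument of $\varphi$ is $0$). $(-\Delta_\Phi)^su(x)=\mathrm{p.v.}\int_{\mathbb{R}^N}\varphi(|D_su(x,y)|)D_su(x,y)\frac{dy}{|x-y|^{N+s}}$ is the fractional $\Phi$-Laplacian, understood weakly. $\|u\|_{q,a}^q=\int a|u|^q\,dx$, $\|u\|_p^p=\int|u|^p\,dx$. A weak solution is $u\in X$ with $\mathcal{J}'(u)v-\mu\int a|u|^{q-2}uv\,dx+\lambda\int|u|^{p-2}uv\,dx=0$ for all $v\in X$. For $u\in X\setminus\{0\}$: $R_n(u)=\frac{\mathcal{J}'(u)u+\lambda\|u\|_p^p}{\|u\|_{q,a}^q}$,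 and $\mu_n(\lambda)=\inf_{u\in X\setminus\{0\}}\inf_{t>0}R_n(tu)$. *)

(* Defs.v *)
From HB Require Import structures.
From mathcomp Require Import all_boot all_order all_algebra.
From mathcomp Require Import all_classical all_reals all_analysis.

Set Implicit Arguments.
Unset Strict Implicit.
Unset Printing Implicit Defensive.
Import Order.TTheory GRing.Theory Num.Theory.
Import numFieldNormedType.Exports.

Local Open Scope classical_set_scope.
Local Open Scope ring_scope.

Section cons_measure.
Context (R : realType) (n : nat).
Notation Rb := (measurableTypeR R).
Variable m : {sigma_finite_measure set (n.-tuple Rb) -> \bar R}.

Definition tuple_cons (z : Rb * n.-tuple Rb) : n.+1.-tuple Rb :=
  [tuple of z.1 :: z.2].

Definition tuple_uncons (t : n.+1.-tuple Rb) : Rb * n.-tuple Rb :=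
  (thead t, [tuple of behead t]).

Lemma measurable_tuple_cons : measurable_fun setT tuple_cons.
Proof. by apply: measurable_cons. Qed.

Lemma measurable_tuple_uncons : measurable_fun setT tuple_uncons.
Proof.
apply/measurable_fun_pairP; split.
  exact: (measurable_tnth ord0).
exact: measurable_behead.
Qed.

Lemma tuple_consK : cancel tuple_cons tuple_uncons.
Proof. by case=> x t; congr pair; apply: val_inj. Qed.

Definition cons_measure : set (n.+1.-tuple Rb) -> \bar R :=
  pushforward (@lebesgue_measure R \x m)%E tuple_cons.

Let cons_measure0 : cons_measure set0 = 0%E.
Proof. by rewrite /cons_measure /pushforward preimage_set0 measure0. Qed.

Let cons_measure_ge0 A : (0 <= cons_measure A)%E.
Proof. by rewrite /cons_measure /pushforward; exact: measure_ge0. Qed.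

Let cons_measure_sigma_additive : semi_sigma_additive cons_measure.
Proof.
have mcons A : measurable A -> measurable (tuple_cons @^-1` A).
  by move=> mA; rewrite -[X in measurable X]setTI; exact: measurable_tuple_cons.
move=> F mF tF mUF; rewrite /cons_measure /pushforward preimage_bigcup.
apply: measure_semi_sigma_additive.
- by move=> k; exact: mcons.
- apply/trivIsetP => /= i j _ _ ij; rewrite -preimage_setI.
  by move/trivIsetP : tF => /(_ _ _ _ _ ij) ->//; rewrite preimage_set0.
- by rewrite -preimage_bigcup; exact: mcons.
Qed.

HB.instance Definition _ := isMeasure.Build _ _ _ cons_measure
  cons_measure0 cons_measure_ge0 cons_measure_sigma_additive.

Let cons_measure_sigma_finite : sigma_finite setT cons_measure.
Proof.
have /sigma_finiteP[F [FT ndF Foo]] := sigma_finiteT (@lebesgue_measure R).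
have /sigma_finiteP[G [GT ndG Goo]] := sigma_finiteT m.
exists (fun k => tuple_uncons @^-1` (F k `*` G k)).
  rewrite predeqE => t; split=> // _.
  have [j _ Fj] : (\bigcup_k F k) (tuple_uncons t).1 by rewrite -FT.
  have [k _ Gk] : (\bigcup_k G k) (tuple_uncons t).2 by rewrite -GT.
  exists (maxn j k) => //; split.
    by move: Fj; exact/subsetPset/ndF/leq_maxl.
  by move: Gk; exact/subsetPset/ndG/leq_maxr.
move=> k; have [mF Fk] := Foo k; have [mG Gk] := Goo k; split.
  rewrite -[X in measurable X]setTI; apply: measurable_tuple_uncons => //.
  exact: measurableX.
rewrite /cons_measure /pushforward -comp_preimage.
rewrite (_ : _ \o _ = id) ?preimage_id; last first.
  by apply/funext => z; exact: tuple_consK.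
by rewrite product_measure1E// lte_mul_pinfty// ge0_fin_numE.
Qed.

HB.instance Definition _ :=
  Measure_isSigmaFinite.Build _ _ _ cons_measure cons_measure_sigma_finite.

End cons_measure.

Fixpoint lebesgue_tuple (R : realType) (n : nat) :
    {sigma_finite_measure set (n.-tuple (measurableTypeR R)) -> \bar R} :=
  match n with
  | 0 => \d_([tuple] : 0.-tuple (measurableTypeR R))
  | n'.+1 => cons_measure (lebesgue_tuple R n')
  end.

(* R^n with the Lebesgue sigma-algebra, i.e. the Caratheodory completion of the
   Borel product measure; [eucl R n] is convertible to [n.-tuple R]. *)
Definition eucl_display (R : realType) (n : nat) : measure_display.
Proof. exact: (caratheodory_display (mu_ext (lebesgue_tuple R n))). Qed.

Section lebesgue_eucl.
Context (R : realType) (n : nat).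
Let outer := mu_ext (lebesgue_tuple R n).
Let T : measurableType _ := caratheodory_type outer.
Let complete := @completed_measure_extension _ (n.-tuple (measurableTypeR R)) R
  (lebesgue_tuple R n).

Definition eucl : Type := caratheodory_type outer.

HB.instance Definition _ := Pointed.on eucl.
HB.instance Definition _ := @isMeasurable.Build (eucl_display R n) eucl
  (@measurable _ T) (@measurable0 _ T) (@measurableC _ T)
  (@bigcupT_measurable _ T).

Definition leb : set eucl -> \bar R := complete.

Let leb0 : leb set0 = 0%E.
Proof. exact: (measure0 complete). Qed.

Let leb_ge0 A : (0 <= leb A)%E.
Proof. exact: (measure_ge0 complete). Qed.

Let leb_sigma_additive : semi_sigma_additive leb.
Proof. exact: (@measure_semi_sigma_additive _ _ _ complete). Qed.

HB.instance Definition _ :=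
  isMeasure.Build _ _ _ leb leb0 leb_ge0 leb_sigma_additive.

Let leb_sigma_finite : sigma_finite setT leb.
Proof. exact/completed_measure_extension_sigma_finite/sigma_finiteT. Qed.

HB.instance Definition _ :=
  Measure_isSigmaFinite.Build _ _ _ leb leb_sigma_finite.

End lebesgue_eucl.

Definition eucl_dist (R : realType) (n : nat) (x y : eucl R n) : R :=
  Num.sqrt (\sum_(i < n) (tnth x i - tnth y i) ^+ 2).

(* Tuples carry no topology in the library; row vectors do. *)
Definition eucl_continuous (R : realType) (n : nat) (f : eucl R n -> R) :=
  continuous (fun r : 'rV[R]_n => f [tuple r ord0 i | i < n]).

Definition tphi (R : realType) (phi : R -> R) (t : R) : R := t * phi t.

(* For phi satisfying the hypotheses of the theorem, finiteness of the infimum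
   and supremum of this set forces (t phi(t))' > 0, so no division by 0 occurs
   (a zero of the derivative would propagate by Gronwall). *)
Definition tphi_ratios (R : realType) (phi : R -> R) : set (\bar R) :=
  [set (derive1 (derive1 (tphi phi)) t * t / derive1 (tphi phi) t)%:E
    | t in `]0, +oo[].

Section fractional_orlicz_sobolev.
Context (R : realType) (N : nat) (s : R) (phi : R -> R) (V : eucl R N -> R).
Implicit Types u v : eucl R N -> R.

(* Only the values of phi on ]0, +oo[ matter: wherever phi is evaluated at 0
   below, it is multiplied by 0. *)
Definition Phi (t : R) : R :=
  \int[lebesgue_measure]_(tau in `[0, `|t|]) tphi phi tau.

Definition Ds u (z : eucl R N * eucl R N) : R :=
  (u z.1 - u z.2) / eucl_dist z.1 z.2 `^ s.

(* Integral against d nu = dx dy / |x - y|^N; the diagonal is Lebesgue-null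
   when N > 0. *)
Definition nu_integral (F : eucl R N * eucl R N -> R) : \bar R :=
  (\int[@leb R N \x @leb R N]_z (F z / eucl_dist z.1 z.2 ^+ N)%:E)%E.

Definition in_orlicz u := measurable_fun setT u /\
  exists2 kappa : R, 0 < kappa &
    (\int[@leb R N]_x (Phi (u x / kappa))%:E < +oo)%E.

Definition in_orlicz_sobolev u := in_orlicz u /\
  exists2 kappa : R, 0 < kappa &
    (nu_integral (fun z => Phi (Ds u z / kappa)) < +oo)%E.

Definition in_X u := in_orlicz_sobolev u /\
  (\int[@leb R N]_x (V x * Phi (u x))%:E < +oo)%E.

(* J'(u)v, for J(u) = \iint Phi(Ds u) d nu + \int V Phi(u) dx. *)
Definition dJ u v : \bar R :=
  (nu_integral (fun z => phi `|Ds u z| * Ds u z * Ds v z)%R +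
   \int[@leb R N]_x (V x * phi `|u x| * u x * v x)%:E)%E.

(* The equation is in \bar R, where +oo - oo = -oo: a sum with an infinite term
   is never 0, so the equation includes the finiteness of its terms. *)
Definition weak_solution (a : eucl R N -> R) (q p lambda mu : R) u :=
  in_X u /\ forall v, in_X v ->
  (dJ u v - mu%:E * \int[@leb R N]_x (a x * `|u x| `^ (q - 2) * u x * v x)%:E
   + lambda%:E * \int[@leb R N]_x (`|u x| `^ (p - 2) * u x * v x)%:E = 0)%E.

Definition nontrivial u := ~ (u = cst 0 %[ae @leb R N]).

Definition rayleigh (a : eucl R N -> R) (q p lambda : R) u : \bar R :=
  ((dJ u u + lambda%:E * \int[@leb R N]_x (`|u x| `^ p)%:E) /
   \int[@leb R N]_x (a x * `|u x| `^ q)%:E)%E.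

Definition mu_n (a : eucl R N -> R) (q p lambda : R) : \bar R :=
  ereal_inf [set ereal_inf [set rayleigh a q p lambda (fun x => t * u x)
                           | t in `]0, +oo[]
            | u in [set u | in_X u /\ nontrivial u]].

End fractional_orlicz_sobolev.

(* Main.v *)
Require Import Defs.
From mathcomp Require Import all_boot all_order all_algebra.
From mathcomp Require Import all_classical all_reals all_analysis.
From mathcomp Require Import measurable_realfun lra.

Set Implicit Arguments.
Unset Strict Implicit.
Unset Printing Implicit Defensive.
Import Order.TTheory GRing.Theory Num.Theory.
Import numFieldNormedType.Exports.

Local Open Scope classical_set_scope.
Local Open Scope ring_scope.

(** A nontrivial weak solution [u] attains the value [mu] in its own Rayleigh
    quotient. Testing the equation with [u] itself gives
    J'(u)u - mu \int a|u|^q + lambda \int |u|^p = 0, and dividing by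
    \int a|u|^q, which is positive because [a > 0] a.e. and [u] is nontrivial,
    yields R_n(u) = mu. Taking t = 1 in the definition of mu_n(lambda) gives
    mu_n(lambda) <= mu.

    The identity lives in the extended reals, so the division needs care
    ([ediv_eq_of_balance]). If \int a|u|^q is infinite and [mu] is not 0, the
    balance contains an infinite term and cannot vanish; if it is infinite and
    [mu] is 0, the product mu \int a|u|^q is 0 by convention and the quotient is
    0 / +oo = 0, which still equals [mu]. *)

(** The exponent is nonzero so that both sides agree at [x = 0], where
    [0 `^ 0 = 1]. *)
Lemma normr_powRB2_sqr (R : realType) (x b : R) : b != 0 ->
  `|x| `^ (b - 2) * x * x = `|x| `^ b.
Proof.
move=> b0; have [->|x0] := eqVneq x 0; first by rewrite mulr0 normr0 powR0.
rewrite -mulrA -expr2 -real_normK ?num_real// -powR_mulrn// -powRD ?subrK//.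
by rewrite normr_eq0 x0 implybT.
Qed.

(** The cancellation behind the Rayleigh quotient, with all three terms allowed
    to be infinite: a sum with an infinite term is never 0. *)
Lemma ediv_eq_of_balance (R : realType) (J A P : \bar R) (mu : R) :
  (0 < A)%E -> (0 <= P)%E -> (J - mu%:E * A + P = 0)%E ->
  ((J + P) / A = mu%:E)%E.
Proof.
case: A => [A| |] // A0 P0 bal.
- case: P P0 bal => [P| |] // P0; last by case: J.
  case: J => [J| |] //; rewrite -?EFinM -?EFinN -?EFinD => -[bal].
  rewrite lte_fin in A0.
  have -> : J + P = mu * A by lra.
  by rewrite inver gt_eqF// -EFinM mulfK ?gt_eqF.
- have [mu0|mu0|mu0] := ltgtP mu 0.
  + move: bal; rewrite lt0_muley ?lte_fin//.
    by case: J => //; case: P P0.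
  + move: bal; rewrite gt0_muley ?lte_fin//.
    by case: J => //; case: P P0.
  + by move: bal; rewrite mu0 mul0e sube0 => ->; rewrite mul0e.
Qed.

(** A vanishing integral would make the a.e. nonnegative integrand vanish a.e.,
    and where the weight is positive this forces [u = 0]. *)
Lemma weighted_powR_integral_gt0 d (T : measurableType d) (R : realType)
    (mu : {measure set T -> \bar R}) (a u : T -> R) (b : R) :
  measurable_fun setT a -> measurable_fun setT u ->
  {ae mu, forall x, 0 < a x} -> ~ (u = cst 0 %[ae mu]) ->
  (0 < \int[mu]_x (a x * `|u x| `^ b)%:E)%E.
Proof.
move=> ma mu_u a0 u0.
pose f (x : T) : \bar R := (a x * `|u x| `^ b)%:E; rewrite -/(f _).
have mf : measurable_fun setT f.
  apply/measurable_EFinP; apply: measurable_funM => //.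
  apply: (measurableT_comp (measurable_powR b)).
  exact: measurableT_comp.
have -> : (\int[mu]_x f x = \int[mu]_x `|f x|)%E.
  apply: ae_eq_integral => //; first exact: measurableT_comp.
  apply: filterS a0 => x ax _ /=.
  by rewrite (ger0_norm (mulr_ge0 (ltW ax) (powR_ge0 _ _))).
rewrite lt_neqAle eq_sym integral_ge0// andbT; apply/eqP.
move=> /(ae_eq_integral_abs mu measurableT mf) f0.
apply: u0; apply: filterS2 a0 f0 => x ax /(_ I) /= [] /eqP.
by rewrite mulf_eq0 gt_eqF//= powR_eq0 normr_eq0 => /andP[/eqP].
Qed.

Theorem theorem1p3 (R : realType) (N : nat) (s : R) (phi : R -> R)
    (l m q p : R) (a V : eucl R N -> R) (lambda mu : R) :
  (1 <= N)%N ->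
  0 < s < 1 ->
  (forall t : R, 0 < t -> 0 < phi t) ->
  (forall t : R, 0 < t -> derivable phi t 1) ->
  (forall t : R, 0 < t -> {for t, continuous (derive1 phi)}) ->
  (forall t : R, 0 < t -> derivable (tphi phi) t 1) ->
  (forall t : R, 0 < t -> derivable (derive1 (tphi phi)) t 1) ->
  tphi phi t @[t --> 0^'+] --> 0 ->
  tphi phi t @[t --> +oo] --> +oo ->
  (forall t1 t2 : R, 0 < t1 -> t1 < t2 -> tphi phi t1 < tphi phi t2) ->
  -1 < l - 2 ->
  (l - 2)%:E = ereal_inf (tphi_ratios phi) ->
  (m - 2)%:E = ereal_sup (tphi_ratios phi) ->
  (\int[lebesgue_measure]_(t in `]0%R, 1%R])
     ((t / Phi phi t) `^ (s / (N%:R - s)))%:E < +oo)%E ->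
  (\int[lebesgue_measure]_(t in `[1%R, +oo[)
     ((t / Phi phi t) `^ (s / (N%:R - s)))%:E = +oo)%E ->
  l <= m -> m < q -> q < p -> p < N%:R * l / (N%:R - l * s) ->
  m * (q - l) < p * (q - m) ->
  measurable_fun setT a ->
  a \in Lfun (@leb R N) (p / (p - q))%:E ->
  {ae @leb R N, forall x, 0 < a x} ->
  eucl_continuous V ->
  (exists2 V0 : R, 0 < V0 & forall x, V0 <= V x) ->
  (forall M : R, 0 < M -> (@leb R N [set x | (V x <= M)%R] < +oo)%E) ->
  0 < lambda ->
  (mu%:E < mu_n s phi V a q p lambda)%E ->
  ~ exists u : eucl R N -> R,
      weak_solution s phi V a q p lambda mu u /\ nontrivial u.
Proof.
move=> _ _ _ _ _ _ _ _ _ _ l1 _ _ _ _ lm mq qp _ _ ma _ a0 _ _ _ la0 mu_lt.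
case=> u [[Xu sol] nt].
(* Both exponents exceed 1, since [1 < l <= m < q < p]. *)
have q0 : q != 0 by rewrite gt_eqF//; lra.
have p0 : p != 0 by rewrite gt_eqF//; lra.
have mu_u : measurable_fun setT u by case: Xu => -[[]].
have A0 := weighted_powR_integral_gt0 q ma mu_u a0 nt.
have bal := sol u Xu.
move: mu_lt; apply/negP; rewrite -leNgt.
suff <- : rayleigh s phi V a q p lambda u = mu%:E.
  apply: (@le_trans _ _ (ereal_inf [set rayleigh s phi V a q p lambda
      (fun x => t * u x) | t in `]0, +oo[])).
    by apply: ereal_inf_lbound; exists u.
  apply: ereal_inf_lbound; exists 1 => /=; first by rewrite in_itv/= ltr01.
  by congr rayleigh; apply/funext => x; rewrite mul1r.
apply: ediv_eq_of_balance => //.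
  apply: mule_ge0; first by rewrite lee_fin ltW.
  by apply: integral_ge0 => x _; rewrite lee_fin powR_ge0.
rewrite -[RHS]bal; congr (_ - _ * _ + _ * _)%E.
all: apply: eq_integral => x _; rewrite -?(mulrA (a x)).
all: by rewrite normr_powRB2_sqr.
Qed.
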